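(* Let $X$ be a real vector space with norm $\|\cdot\|$, $\mathcal{D}\subset X$ a nonempty convex set whose linear span is $X$, and $\mathcal{V}$ the topological dual of $(X,\|\cdot\|)$, with evaluation pairing $\langle v,x\rangle$ and dual norm $\|\cdot\|'$. Let $F:\mathcal{D}\to\mathbb{R}$ be convex and bounded below, such that $F$, extended to the completion of $(X,\|\cdot\|)$ by the value $+\infty$ off $\mathcal{D}$, is lower semicontinuous. For $v\in\mathcal{V}$ let $E(v)=\inf\{F(\rho)+\langle v,\rho\rangle:\rho\in\mathcal{D}\}$ and assume $E(v)>-\infty$ for every $v\in\mathcal{V}$. Let $\Delta(v,\rho)=F(\rho)+\langle v,\rho\rangle-E(v)$ on $\mathcal{V}\times\mathcal{D}$. Let $\epsilon\ge0$ and let $(v_n,\rho_n)_{n\in\mathbb{N}}$ be a sequence in $\mathcal{V}\times\mathcal{D}$ with $\Delta(v_n,\rho_n)\le\epsilon$ for all $n$ and $\|v_n-v\|'\to0$ for some $v\in\mathcal{V}$. Then $\limsup_{n\to\infty}\Delta(v,\rho_n)\le\epsilon$. More precisely, there is a constant $c$ such that for all $n$, $$\Delta(v,\rho_n)\le\epsilon+c\,\|v-v_n\|'.$$ *)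

(* Defs.v *)
From HB Require Import structures.
From mathcomp Require Import all_boot all_order all_algebra.
From mathcomp Require Import all_classical all_reals all_analysis.

Set Implicit Arguments.
Unset Strict Implicit.
Unset Printing Implicit Defensive.

Import Order.TTheory GRing.Theory Num.Theory.
Import numFieldNormedType.Exports.

Local Open Scope classical_set_scope.
Local Open Scope ring_scope.

Record dual (R : realType) (X : normedModType R) := Dual {
  dual_fun :> {linear X -> R^o} ;
  dual_continuous : continuous dual_fun }.

Lemma dual_sub_continuous (R : realType) (X : normedModType R)
  (v w : dual X) : continuous (v \- w).
Proof. by move=> x; apply: continuousB; exact: dual_continuous. Qed.

Definition dual_sub (R : realType) (X : normedModType R) (v w : dual X) :
  dual X := @Dual R X (v \- w) (@dual_sub_continuous R X v w).

(* The set is nonempty (x = 0) and bounded above by continuity of v, so this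
   real supremum is never the junk value of sup. *)
Definition dual_norm (R : realType) (X : normedModType R) (v : dual X) : R :=
  sup [set `|v x| | x in [set x : X | `|x| <= 1]].

Definition linear_span (R : realType) (X : lmodType R) (D : set X) : set X :=
  [set x | exists (n : nat) (a : 'I_n -> R) (d : 'I_n -> X),
    (forall i, D (d i)) /\ x = \sum_(i < n) a i *: d i].

(* The completion of X, determined up to a unique linear isometry over X: a
   Banach space Y with an isometric linear embedding j of X as a dense
   subspace. *)
Definition is_completion (R : realType) (X : normedModType R)
    (Y : completeNormedModType R) (j : {linear X -> Y}) : Prop :=
  (forall x : X, `|j x| = `|x|) /\ dense (range j).

(* F is a total function on X of which only the values on D are ever used. For
   j injective, 'pinv_(fun=> 0) D j y is the unique x in D with j x = y. *)
Definition extend_pinfty (R : realType) (X Y : lmodType R) (j : X -> Y)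
    (D : set X) (F : X -> R) (y : Y) : \bar R :=
  if y \in j @` D then (F ('pinv_(fun=> 0) D j y))%:E else +oo%E.

Definition ground_energy (R : realType) (X : normedModType R) (D : set X)
    (F : X -> R) (v : dual X) : \bar R :=
  ereal_inf [set (F rho + v rho)%:E | rho in D].

Definition excess_energy (R : realType) (X : normedModType R) (D : set X)
    (F : X -> R) (v : dual X) (rho : X) : \bar R :=
  ((F rho)%:E + (v rho)%:E - ground_energy D F v)%E.

(* Main.v *)
Require Import Defs.
From HB Require Import structures.
From mathcomp Require Import all_boot all_order all_algebra.
From mathcomp Require Import all_classical all_reals all_analysis.
From mathcomp Require Import lra ring.

Import Order.TTheory GRing.Theory Num.Theory.
Import numFieldNormedType.Exports.

Local Open Scope classical_set_scope.
Local Open Scope ring_scope.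

(** The ground energy E is an infimum of continuous affine functionals which is
finite on the whole dual, so a gliding hump argument shows that E is bounded
below on a ball around v: otherwise small functionals along which E is very
negative could be summed, by completeness of the dual, to a functional of energy
-oo. Concavity of E then gives E (v_n) - E v <= c |v_n - v|. Testing the
minimality of rho_n against v_n + s (v_n - v), with s |v_n - v| of the order of
the radius of that ball, bounds <v - v_n, rho_n> linearly in |v - v_n|. The two
estimates add up, since Delta (v, rho_n) = Delta (v_n, rho_n) +
<v - v_n, rho_n> + E (v_n) - E v. *)

(** * Continuous functionals and the dual norm *)

Lemma dual_bounded {R : realType} {X : normedModType R} (v : dual X) :
  exists2 M, 0 < M & forall x, `|v x| <= M * `|x|.
Proof.
have /linear_boundedP : bounded_near v (nbhs 0).
  by apply: continuous_linear_bounded; exact: dual_continuous.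
move=> [M [_ vM]]; exists (Num.max M 0 + 1).
  by rewrite ltr_pwDr// le_max lexx orbT.
by apply: vM; rewrite ltr_pwDr// le_max lexx.
Qed.

Lemma dual_of_bounded {R : realType} {X : normedModType R} (f : X -> R) (M : R) :
    (forall a x y, f (a *: x + y) = a * f x + f y) ->
    (forall x, `|f x| <= M * `|x|) ->
  exists v : dual X, forall x, v x = f x.
Proof.
move=> flin fM.
have flin' : linear (f : X -> R^o) by move=> a x y; exact: flin.
pose fL := GRing.isLinear.Build R X R^o _ f flin'.
pose g : {linear X -> R^o} := HB.pack f fL.
have gc : continuous g.
  apply: bounded_linear_continuous; apply/linear_boundedP.
  exists M; split=> [|N MN x]; first exact: num_real.
  by rewrite (le_trans (fM x))// ler_wpM2r// ltW.
by exists (Dual gc).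
Qed.

(** [dual X] carries no module structure here; linear combinations are supplied through a pointwise
    equation. *)
Lemma dual_comb {R : realType} {X : normedModType R} (a : R) (v w : dual X) :
  exists u : dual X, forall x, u x = a * v x + w x.
Proof.
have [M M0 vM] := dual_bounded v; have [N N0 wN] := dual_bounded w.
apply: (@dual_of_bounded _ _ _ (`|a| * M + N)) => [b x y|x].
  by rewrite !linearP /= /GRing.scale /=; ring.
rewrite (le_trans (ler_normD _ _))// normrM mulrDl lerD// -mulrA.
by rewrite ler_wpM2l.
Qed.

Lemma dual_norm_has_ubound {R : realType} {X : normedModType R} (v : dual X) :
  has_ubound [set `|v x| | x in [set x : X | `|x| <= 1]].
Proof.
have [M M0 vM] := dual_bounded v.
exists M => _ [y /= y1 <-]; rewrite (le_trans (vM y))//.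
by rewrite -[leRHS]mulr1 ler_wpM2l// ltW.
Qed.

Lemma dual_norm_ge0 {R : realType} {X : normedModType R} (v : dual X) :
  0 <= dual_norm v.
Proof.
apply: ub_le_sup; first exact: dual_norm_has_ubound.
by exists 0 => /=; rewrite ?normr0 ?ler01// linear0 normr0.
Qed.

Lemma le_dual_norm {R : realType} {X : normedModType R} (v : dual X) (x : X) :
  `|v x| <= dual_norm v * `|x|.
Proof.
have [->|x0] := eqVneq x 0; first by rewrite linear0 !normr0 mulr0.
have nx0 : `|x| != 0 by rewrite normr_eq0.
rewrite -ler_pdivrMr ?normr_gt0//.
apply: ub_le_sup; first exact: dual_norm_has_ubound.
exists (`|x|^-1 *: x) => /=.
  by rewrite normrZ normfV normr_id mulVf.
by rewrite linearZ /= normrM normfV normr_id mulrC.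
Qed.

Lemma dual_norm_subC {R : realType} {X : normedModType R} (v w : dual X) :
  dual_norm (dual_sub v w) = dual_norm (dual_sub w v).
Proof.
congr sup; apply/seteqP.
by split=> _ [x x1 <-]; exists x => //=; rewrite distrC.
Qed.

(** * Geometric decay and completeness of the dual *)

Section halving_sequence.
Context {R : realType} (r : nat -> R).
Hypothesis r_ge0 : forall k, 0 <= r k.
Hypothesis r_half : forall k, r k.+1 <= r k / 2.

Lemma halving_geometric k : r k * 2 ^+ k <= r 0.
Proof.
elim: k => [|k IH]; first by rewrite expr0 mulr1.
by apply: le_trans IH; rewrite exprS mulrA ler_wpM2r ?exprn_ge0// -ler_pdivlMr.
Qed.

(** Since [r k] is at most r 0 / 2^k, a positive [z] would bound all powers of 2. *)
Lemma halving_squeeze (C z : R) : (forall k, z <= C * r k) -> z <= 0.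
Proof.
move=> zC; rewrite leNgt; apply/negP => z0.
pose k := Num.Def.archi_bound (`|C| * r 0 / z).
have := @upper_nthrootP _ (`|C| * r 0 / z) k (leqnn _).
rewrite ltr_pdivrMr// => Ck.
have zk : z * 2 ^+ k <= `|C| * (r k * 2 ^+ k).
  rewrite mulrA ler_wpM2r ?exprn_ge0//.
  by rewrite (le_trans (zC k))// ler_wpM2r// ler_norm.
have := ler_wpM2l (normr_ge0 C) (halving_geometric k).
lra.
Qed.

(** As [r l <= 2 * (r l - r l.+1)], the increments are dominated by a telescoping sum. *)
Lemma halving_series_bound (a : nat -> R) (c : R) :
    (forall k, `|a k.+1 - a k| <= c * r k) ->
  forall k l, (k <= l)%N -> `|a l - a k| <= 2 * c * (r k - r l).
Proof.
move=> ac k; elim=> [|l IH].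
  by rewrite leqn0 => /eqP ->; rewrite !subrr normr0 mulr0.
rewrite leq_eqVlt => /orP[/eqP -> |/IH akl].
  by rewrite !subrr normr0 mulr0.
have := ac l; have := r_half l; have := r_ge0 l; move: akl.
have c0 : 0 <= c * r l by rewrite (le_trans _ (ac l)).
rewrite -[a l.+1 - a k](subrKA (a l)) => h1 h2 h3 h4.
rewrite (le_trans (ler_normD _ _))//.
(* The sign of [c] is known only when [r l] is nonzero; otherwise the increment vanishes. *)
have [rl0|rl0] := eqVneq (r l) 0; last first.
  have {}c0 : 0 <= c by move: c0; rewrite pmulr_lge0// lt_def rl0.
  nra.
have rl10 : r l.+1 = 0 by have := r_ge0 l.+1; lra.
rewrite rl0 in h4, h1; rewrite rl10; lra.
Qed.

(* The dual space is complete: here the limit is taken pointwise as the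
   supremum of the increasing sequence [u k x - 2 * r k * `|x|]. *)
Lemma dual_halving_limit {X : normedModType R} (u : nat -> dual X) :
    (forall k x, `|u k.+1 x - u k x| <= r k * `|x|) ->
  exists ul : dual X, forall k x, `|ul x - u k x| <= 2 * r k * `|x|.
Proof.
move=> ur.
have ukl x k l : (k <= l)%N -> `|u l x - u k x| <= 2 * `|x| * (r k - r l).
  by apply: (halving_series_bound (u ^~ x)) => i; rewrite mulrC.
pose f x := sup [set u k x - 2 * r k * `|x| | k in setT].
have fu k x : `|f x - u k x| <= 2 * r k * `|x|.
  have ub : ubound [set u k x - 2 * r k * `|x| | k in setT]
      (u k x + 2 * r k * `|x|).
    move=> _ [l _ <-]; have [kl|/ltnW lk] := leqP k l.
      have := ukl x _ _ kl; rewrite ler_norml => /andP[_].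
      have := mulr_ge0 (r_ge0 l) (normr_ge0 x); lra.
    have := ukl x _ _ lk; rewrite ler_norml => /andP[+ _].
    have := mulr_ge0 (r_ge0 k) (normr_ge0 x); lra.
  rewrite ler_distl; apply/andP; split.
    by apply: ub_le_sup; [exists (u k x + 2 * r k * `|x|)|exists k].
  by apply: ge_sup => //; exists (u k x - 2 * r k * `|x|), k.
have [M M0 uM] := dual_bounded (u 0).
have [||ul ulE] := @dual_of_bounded _ _ f (2 * r 0 + M); last first.
- by exists ul => k x; rewrite ulE.
- move=> x; have := fu 0%N x; have := uM x.
  rewrite mulrDl => h1 h2.
  have := ler_normD (f x - u 0%N x) (u 0%N x); rewrite subrK => h3.
  by apply: le_trans h3 _; move: h1 h2; lra.
(* The defect of linearity is at most a constant times [r k] for every [k], hence zero. *)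
move=> a x y; apply/eqP; rewrite -subr_eq0 -normr_le0.
apply: (@halving_squeeze (2 * (`|a *: x + y| + `|a| * `|x| + `|y|))) => k.
have := fu k (a *: x + y); have := fu k y.
have := ler_wpM2l (normr_ge0 a) (fu k x); rewrite -normrM.
rewrite linearP /= /GRing.scale /= => h1 h2 h3.
rewrite (_ : f _ - _ = (f (a *: x + y) - (a * u k x + u k y))
   - (a * (f x - u k x)) - (f y - u k y)); last by ring.
rewrite (le_trans (ler_normB _ _))//.
have := ler_normB (f (a *: x + y) - (a * u k x + u k y)) (a * (f x - u k x)).
lra.
Qed.

End halving_sequence.

(** * Local boundedness below by a gliding hump *)

Section bounded_below.
Context {R : realType} {X : normedModType R} (D : set X) (F : X -> R).
Hypothesis F_dual_lbound :
  forall w : dual X, exists m, forall rho, D rho -> m <= F rho + w rho.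

(* Averaging a very negative value of [F + w] near [0] against the lower bound
   of [F - u] moves it to [u + 2 w]. *)
Lemma unbounded_everywhere :
    (forall r M : R, 0 < r -> exists w : dual X, exists rho,
      [/\ forall x, `|w x| <= r * `|x|, D rho & F rho + w rho < M]) ->
  forall (u : dual X) (r M : R), 0 < r -> exists u' : dual X, exists rho,
    [/\ forall x, `|u' x - u x| <= r * `|x|, D rho & F rho + u' rho < M].
Proof.
move=> unb u r M r0.
have [nu nuE] := dual_comb (- 2) u u.
have [m mE] := F_dual_lbound nu.
(* By F + (u + 2 w) = 2 (F + w) - (F - u), the threshold [(M + m) / 2] yields a value below [M]; the
   factor 2 also explains the radius [r / 2]. *)
have [|w [rho [wr Drho wM]]] := unb (r / 2) ((M + m) / 2).
  by rewrite divr_gt0.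
have [u' u'E] := dual_comb 2 w u.
exists u', rho; split => // [x|].
  by rewrite u'E addrK normrM ger0_norm//; have := wr x; lra.
by have := mE _ Drho; rewrite nuE u'E; lra.
Qed.

Lemma locally_bounded_below : exists r M : R, 0 < r /\
  forall w : dual X, (forall x, `|w x| <= r * `|x|) ->
    forall rho, D rho -> M <= F rho + w rho.
Proof.
apply: contrapT => nbounded.
have /unbounded_everywhere unb : forall r M : R, 0 < r ->
    exists w : dual X, exists rho,
      [/\ forall x, `|w x| <= r * `|x|, D rho & F rho + w rho < M].
  move=> r M r0; apply: contrapT => nw; apply: nbounded.
  exists r, M; split=> // w wr rho Drho; rewrite leNgt; apply/negP => wM.
  by apply: nw; exists w, rho.
(* The radius of the next step is so small that no later step can undo the
   very negative value found at [rho]. *)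
pose step (s s' : dual X * R) := 0 < s.2 -> exists rho,
  [/\ D rho, 0 < s'.2 <= s.2 / 2, s'.2 * `|rho| <= 2^-1,
      forall x, `|s'.1 x - s.1 x| <= s.2 * `|x| &
      F rho + s'.1 rho < - s.2^-1].
have [zero _] : exists zero : dual X, forall x, zero x = 0.
  apply: (@dual_of_bounded _ _ (fun=> 0) 0) => [a x y|x].
    by rewrite mulr0 addr0.
  by rewrite normr0 mul0r.
have stepE s : {s' | step s s'}.
  (* Dependent choice needs a total relation: a nonpositive radius gets a vacuous successor. *)
  apply: cid; case: s => u r; have [r0|r0] := ltP 0 r; last first.
    by exists (u, r) => /=; rewrite /step/= ltNge r0.
  have [u' [rho [ur Drho uM]]] := unb u r (- r^-1) r0.
  pose t := (2 * (1 + `|rho|))^-1.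
  have t0 : 0 < t by rewrite invr_gt0 mulr_gt0// ltr_pwDl.
  exists (u', Num.min (r / 2) t) => _; exists rho; split=> //=.
    by rewrite lt_min t0 divr_gt0//= ge_min lexx.
  apply: (@le_trans _ _ (t * `|rho|)).
    by rewrite ler_wpM2r// ge_min lexx orbT.
  rewrite /t mulrC ler_pdivrMr ?mulr_gt0 ?ltr_pwDl//.
  by rewrite mulKf// lerDr.
have [s [s0 sS]] := dependent_choice stepE (zero, 1).
pose r k := (s k).2; pose u k := (s k).1.
have r_gt0 k : 0 < r k.
  elim: k => [|k IH]; first by rewrite /r s0.
  by have [rho [_ /andP[]]] := sS k IH.
have r_half k : r k.+1 <= r k / 2.
  by have [rho [_ /andP[]]] := sS k (r_gt0 k).
have r_ge0 k : 0 <= r k := ltW (r_gt0 k).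
have ur k x : `|u k.+1 x - u k x| <= r k * `|x|.
  by have [rho [_ _ _]] := sS k (r_gt0 k).
have [ul ulE] := dual_halving_limit r r_ge0 r_half u ur.
have [m mE] := F_dual_lbound ul.
suff : 1 <= (0 : R) by lra.
(* Passing from [u k.+1] to [ul] changes the value at [rho] by at most 2 r_(k+1) |rho| <= 1, so m <
   1 - 1 / r_k for every [k], although [r] tends to 0. *)
apply: (halving_squeeze r r_ge0 r_half (1 - m)) => k.
have [rho [Drho _ rrho _ uM]] := sS k (r_gt0 k).
rewrite -ler_pdivrMr// div1r.
have := mE _ Drho; have := ulE k.+1 rho.
rewrite ler_norml => /andP[_]; move: uM rrho; rewrite -/(r k.+1) -/(u k.+1) -/(r k).
lra.
Qed.

End bounded_below.

(** * Ground energy and the linear estimate near [v] *)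

Section energy.
Context {R : realType} {X : normedModType R} (D : set X) (F : X -> R).
Hypothesis D_nonempty : D !=set0.
Hypothesis E_gt_ninfty : forall w : dual X, (-oo < ground_energy D F w)%E.

Let E (w : dual X) : R := fine (ground_energy D F w).

Lemma ground_energy_fineK (w : dual X) : ((E w)%:E = ground_energy D F w)%E.
Proof.
rewrite /E fineK// fin_numElt E_gt_ninfty /=.
have [rho Drho] := D_nonempty.
by apply: (@le_lt_trans _ _ (F rho + w rho)%:E); rewrite ?ltry//;
  apply: ereal_inf_lbound; exists rho.
Qed.

Lemma ground_energy_le (w : dual X) (rho : X) : D rho -> E w <= F rho + w rho.
Proof.
move=> Drho; rewrite -lee_fin ground_energy_fineK.
by apply: ereal_inf_lbound; exists rho.
Qed.

Lemma ground_energy_ge (w : dual X) (m : R) :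
  (forall rho, D rho -> m <= F rho + w rho) -> m <= E w.
Proof.
move=> mE; rewrite -lee_fin ground_energy_fineK.
by apply: le_ereal_inf_tmp => _ [rho Drho <-]; rewrite lee_fin mE.
Qed.

Lemma excess_energyE (w : dual X) (rho : X) :
  excess_energy D F w rho = (F rho + w rho - E w)%:E.
Proof. by rewrite /excess_energy -ground_energy_fineK EFinB EFinD. Qed.

(** With h = w - v, the excess at [v] is the excess at [w] plus (E w - E v) - h rho; each of these
    two terms is at most a multiple of d / r. *)
Lemma excess_energy_lipschitz (v : dual X) (r M eps : R) : 0 < r -> 0 <= eps ->
    (forall w : dual X, (forall x, `|w x| <= r * `|x|) ->
       forall rho, D rho -> M <= F rho + v rho + w rho) ->
  forall (w : dual X) (d : R) (rho : X), 0 <= d <= r / 2 ->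
    (forall x, `|w x - v x| <= d * `|x|) -> D rho ->
    F rho + w rho - E w <= eps ->
  F rho + v rho - E v <= eps + (4 * (E v - M) + 2 * eps) / r * d.
Proof.
move=> r0 eps0 MF w d rho /andP[d0 dr] wd Drho wrho.
have [h hE] := dual_comb (- 1) v w.
have hd x : `|h x| <= d * `|x| by rewrite hE mulN1r addrC.
(* The case d = 0 is separate because [h] is rescaled by r / d below. *)
move: d0; rewrite le_eqVlt => /predU1P[d0|d0].
  have wv x : w x = v x.
    by apply/eqP; rewrite -subr_eq0 -normr_le0 (le_trans (wd x))// -d0 mul0r.
  have Evw : E w <= E v.
    by apply: ground_energy_ge => x Dx; rewrite -wv; exact: ground_energy_le.
  by move: wrho; rewrite -d0 mulr0 wv; lra.
have [zero zeroE] := dual_comb (- 1) v v.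
have hscale (a : R) : `|a| * d <= r -> forall x, D x -> M <= F x + v x + a * h x.
  move=> ad x Dx; have [ah ahE] := dual_comb a h zero.
  have ahE' y : ah y = a * h y by rewrite ahE zeroE mulN1r addNr addr0.
  rewrite -ahE'; apply: MF => // y; rewrite ahE' normrM.
  by rewrite (le_trans (ler_wpM2l _ (hd y)))// mulrA ler_wpM2r.
have d_neq0 : d != 0 by rewrite gt_eqF.
have MEv : M <= E v.
  apply: ground_energy_ge => x Dx.
  by have := hscale 0 _ x Dx; rewrite normr0 !mul0r addr0; apply; exact: ltW.
have Ewv : E w - E v <= (E v - M) * (d / r).
  (* [v] is a convex combination of [w] and [v - (r / d) *: h] *)
  have : (r * E w + d * M) / (r + d) <= E v.
    apply: ground_energy_ge => x Dx.
    have /(_ _ x Dx) := hscale (- (r / d)).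
    rewrite normrN gtr0_norm ?divr_gt0// divfK// lexx => /(_ isT) hM.
    have := ler_wpM2l (ltW r0) (ground_energy_le w x Dx).
    have := ler_wpM2l (ltW d0) hM.
    rewrite [d * (_ + _)]mulrDr mulNr mulrN [d * (r / d * _)]mulrA mulrCA divff//.
    rewrite hE ler_pdivrMr ?addr_gt0//; lra.
  rewrite ler_pdivrMr ?addr_gt0// => Ev.
  by rewrite mulrA ler_pdivlMr//; lra.
(* The test functional v + (1 + r / (2 d)) h = w + (r / (2 d)) h stays within d + r / 2 <= r of [v],
   and [rho] almost minimizes F + w. *)
have hrho : - h rho <= 2 * (E w + eps - M) * (d / r).
  have /(_ _ rho Drho) := hscale (1 + r / (2 * d)).
  have p0 : 0 < 1 + r / (2 * d) by rewrite addr_gt0// divr_gt0// mulr_gt0.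
  rewrite gtr0_norm//.
  have -> : (1 + r / (2 * d)) * d = d + r / 2 by field.
  have -> : d + r / 2 <= r by lra.
  move=> /(_ isT); rewrite mulrDl mul1r => hM.
  have {}hM : - (r / (2 * d) * h rho) <= E w + eps - M.
    by move: hM wrho; rewrite hE; lra.
  have -> : 2 * (E w + eps - M) * (d / r) = (E w + eps - M) * (2 * d) / r.
    by ring.
  rewrite ler_pdivlMr//.
  have := ler_wpM2r (_ : 0 <= 2 * d) hM => /(_ (mulr_ge0 _ (ltW d0))).
  have -> : - (r / (2 * d) * h rho) * (2 * d) = - h rho * r by field.
  by apply.
have q0 : 0 < d / r by rewrite divr_gt0.
have qle : d / r <= 2^-1 by rewrite ler_pdivrMr//; lra.
have -> : (4 * (E v - M) + 2 * eps) / r * d = (4 * (E v - M) + 2 * eps) * (d / r).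
  by ring.
move: Ewv hrho; rewrite hE; move: (d / r) q0 qle => q q0 qle Ewv hrho.
(* From q <= 1/2, E w <= E v + (E v - M) / 2, so - h rho <= (3 (E v - M) + 2 eps) q; adding [Ewv]
   gives the factor 4. *)
have : (E v - M) * q <= (E v - M) * 2^-1 by rewrite ler_wpM2l//; lra.
move=> Eq.
have : 2 * (E w + eps - M) * q <= 2 * (E v + (E v - M) / 2 + eps - M) * q.
  by rewrite ler_wpM2r//; lra.
lra.
Qed.

End energy.

(** * Limit superior and assembly of the bounds *)

Lemma limn_esup_le_bound {R : realType} (u : nat -> \bar R) (l : R) :
    (forall e : R, 0 < e -> \forall n \near \oo, (u n <= (l + e)%:E)%E) ->
  (limn_esup u <= l%:E)%E.
Proof.
move=> ul; apply/lee_addgt0Pr => e e0.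
(* The limit superior is an infimum of suprema over neighbourhoods of infinity, and this set is one
   of them. *)
apply: (@le_trans _ _ (ereal_sup (u @` [set n | (u n <= (l + e)%:E)%E]))).
  by apply: ereal_inf_lbound; exists [set n | (u n <= (l + e)%:E)%E]; [exact: ul|].
by apply: ge_ereal_sup => _ [n + <-].
Qed.

(* The finitely many indices not covered by [near] are absorbed in the constant. *)
Lemma linear_bound_near {R : realType} (a d : nat -> R) (c l r : R) : 0 < r ->
    (forall n, 0 <= d n) ->
    (forall n, d n <= r -> a n <= l + c * d n) ->
    (\forall n \near \oo, d n <= r) ->
  exists C, forall n, a n <= l + C * d n.
Proof.
move=> r0 d0 acd [N _ dr].
(* An exceptional index has d n / r > 1, so its summand times [d n] already exceeds |a n - l|, up to
   equality. *)
pose S := \sum_(i < N) `|a i - l| / r.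
have S0 : 0 <= S by apply: sumr_ge0 => i _; rewrite divr_ge0// ltW.
exists (`|c| + S) => n.
have dc : c * d n <= `|c| * d n by rewrite ler_wpM2r// ler_norm.
have dS : 0 <= S * d n by rewrite mulr_ge0.
have [drn|rdn] := leP (d n) r; first by have := acd _ drn; lra.
have nN : (n < N)%N.
  by rewrite ltnNge; apply/negP => /dr /=; rewrite leNgt rdn.
have : `|a n - l| / r <= S.
  rewrite /S (bigD1 (Ordinal nN))//= lerDl.
  by apply: sumr_ge0 => i _; rewrite divr_ge0// ltW.
move=> /(ler_wpM2r (d0 n)).
have : `|a n - l| <= `|a n - l| / r * d n.
  by rewrite -mulrA ler_peMr// mulrC ler_pdivlMr// mul1r ltW.
have := ler_norm (a n - l); have := mulr_ge0 (normr_ge0 c) (d0 n).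
lra.
Qed.

Theorem mainTheorem5 (R : realType) (X : normedModType R)
  (Y : completeNormedModType R) (j : {linear X -> Y})
  (D : set X) (F : X -> R)
  (hY : is_completion j)
  (D_nonempty : D !=set0)
  (D_convex : convex_set D)
  (D_span : linear_span D = setT)
  (F_convex : convex_function D F)
  (F_bounded_below : has_lbound (F @` D))
  (F_lsc : lower_semicontinuous (extend_pinfty j D F))
  (E_gt_ninfty : forall w : dual X, (-oo < ground_energy D F w)%E)
  (eps : R) (eps_ge0 : 0 <= eps)
  (v_ : nat -> dual X) (rho_ : nat -> X)
  (rho_in_D : forall n, D (rho_ n))
  (excess_le : forall n, (excess_energy D F (v_ n) (rho_ n) <= eps%:E)%E)
  (v : dual X)
  (v_cvg : dual_norm (dual_sub (v_ n) v) @[n --> \oo] --> (0 : R)) :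
  (limn_esup (fun n => excess_energy D F v (rho_ n)) <= eps%:E)%E /\
  exists c : R, forall n,
    (excess_energy D F v (rho_ n) <=
       eps%:E + c%:E * (dual_norm (dual_sub v (v_ n)))%:E)%E.
Proof.
have F_dual_lbound (w : dual X) : exists m, forall rho, D rho -> m <= F rho + w rho.
  by exists (fine (ground_energy D F w)) => rho; exact: ground_energy_le.
(* Replacing F by F + v moves the centre of the ball from 0 to [v]. *)
have [r [M [r0 MF]]] : exists r M : R, 0 < r /\
    forall w : dual X, (forall x, `|w x| <= r * `|x|) ->
      forall rho, D rho -> M <= F rho + v rho + w rho.
  apply: (locally_bounded_below D (fun x => F x + v x)) => w.
  have [u uE] := dual_comb 1 v w; have [m mE] := F_dual_lbound u.
  by exists m => rho /mE; rewrite uE mul1r addrA.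
pose E w := fine (ground_energy D F w).
pose d n := dual_norm (dual_sub v (v_ n)).
have d0 n : 0 <= d n by exact: dual_norm_ge0.
have dE : (fun n => dual_norm (dual_sub (v_ n) v)) = d.
  by apply/funext => n; exact: dual_norm_subC.
rewrite dE in v_cvg.
have d_near e : 0 < e -> \forall n \near \oo, d n <= e.
  move=> e0; near=> n; rewrite -[d n]ger0_norm//; apply/ltW.
  by near: n; exact: cvgr0_norm_lt.
have [C CE] : exists C, forall n, F (rho_ n) + v (rho_ n) - E v <= eps + C * d n.
  have r20 : 0 < r / 2 by rewrite divr_gt0.
  apply: (linear_bound_near _ d ((4 * (E v - M) + 2 * eps) / r) _ (r / 2)) => //.
    move=> n dnr; apply: (excess_energy_lipschitz D F _ _ v r M _ _ _ _ (v_ n)) => //.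
    - by rewrite d0.
    - by move=> x; rewrite distrC; exact: le_dual_norm (dual_sub v (v_ n)) x.
    - by rewrite -lee_fin -excess_energyE.
  exact: d_near.
have excessE n : (excess_energy D F v (rho_ n) <= eps%:E + C%:E * (d n)%:E)%E.
  by rewrite excess_energyE// lee_fin.
split; last by exists C.
apply: limn_esup_le_bound => e e0.
(* Adding 1 keeps the divisor positive when [C] is 0. *)
have C0 : 0 < `|C| + 1 by rewrite ltr_pwDr.
near=> n.
have : d n <= e / (`|C| + 1) by near: n; apply: d_near; rewrite divr_gt0.
rewrite ler_pdivlMr// => dne.
apply: le_trans (excessE n) _; rewrite lee_fin lerD2l (le_trans _ dne)//.
by rewrite mulrC ler_wpM2l// (le_trans (ler_norm _))// lerDl.
Unshelve. all: by end_near. Qed.
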